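(* Suppose $\eta$ is a random particle configuration whose path encoding $S$ has distribution supported in $\mathcal{S}^{rev}$ (that is, $S\in\mathcal{S}^{rev}$, $\mathbf{P}$-a.s.), and which satisfies $T\eta\overset{d}{=}\eta$. Then \[S\in\mathcal{S}_{sub-critical}\cup\mathcal{S}_{critical},\qquad\mathbf{P}\text{-a.s.}\] Moreover, there exists a constant $\rho\in[0,\tfrac12]$ such that \[\mathbf{P}(\eta_n=1)=\rho,\qquad \forall n\in\mathbb{Z},\] where $\rho=\tfrac12$ if and only if $S\in \mathcal{S}_{critical}$, $\mathbf{P}$-a.s.
   Context: $\mathbb{N}=\{1,2,\dots\}$. A particle configuration is $\eta=(\eta_n)_{n\in\mathbb{Z}}\in\{0,1\}^{\mathbb{Z}}$; a random one is defined on a probability space with probability measure $\mathbf{P}$. Its path encoding is $S=(S_n)_{n\in\mathbb{Z}}$ with $S_0=0$, $S_n-S_{n-1}=1-2\eta_n$. This identifies $\{0,1\}^{\mathbb{Z}}$ with $\mathcal{S}^0=\{S:\mathbb{Z}\to\mathbb{Z} : S_0=0,\ |S_n-S_{n-1}|=1\ \forall n\}$. Let $M_n=\sup_{m\le n}S_m$, $I_n=\inf_{m\ge n}S_m$. $TS$ is well-defined iff $M_0<\infty$, with $(TS)_n=2M_n-S_n-2M_0$; $T^{-1}S$ is well-defined iff $I_0>-\infty$, with $(T^{-1}S)_n=2I_n-S_n-2I_0$. $T\eta$ is the configuration with path encoding $TS$. Define \[\mathcal{S}^{rev}=\{S\in \mathcal{S}^0 : TS,\ T^{-1}S,\ T^{-1}TS,\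 TT^{-1}S\text{ well-defined},\ T^{-1}TS=S,\ TT^{-1}S=S\}.\] Let $\mathcal{S}_{sub-critical}^{\pm}$ be the set of $S\in\mathcal{S}^0$ with $\lim_{n\to\pm\infty}S_n/F(n)=1$ for some strictly increasing $F:\mathbb{Z}\to\mathbb{R}$, and $\mathcal{S}_{critical}^{\pm}$ the set of $S\in\mathcal{S}^0$ with $\sup_{n\in\mathbb{Z}}(M_n-I_n)=\limsup_{n\to\pm\infty}S_n-\liminf_{n\to\pm\infty}S_n=K$ for some $K\in\mathbb{N}$. Set $\mathcal{S}_{sub-critical}=\mathcal{S}_{sub-critical}^-\cap\mathcal{S}_{sub-critical}^+$ and $\mathcal{S}_{critical}=\mathcal{S}_{critical}^-\cap\mathcal{S}_{critical}^+$. *)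

(* Defs.v *)
From HB Require Import structures.
From mathcomp Require Import all_boot all_order all_algebra.
From mathcomp Require Import all_classical all_reals all_analysis.

Set Implicit Arguments.
Unset Strict Implicit.
Unset Printing Implicit Defensive.

Import Order.TTheory GRing.Theory Num.Theory.
Import numFieldNormedType.Exports.

Local Open Scope classical_set_scope.
Local Open Scope ring_scope.

(* {0,1}^Z with the product sigma-algebra, i.e. the one generated by the
   coordinate maps. *)
Definition coord_cylinders : set (set (int -> bool)) :=
  \bigcup_(n in [set: int])
    preimage_set_system setT (fun e : int -> bool => e n) measurable.

Definition config := g_sigma_algebraType coord_cylinders.

Definition step (eta : config) (n : int) : int := 1 - 2 * (eta n : nat)%:Z.

(* The unique S with S_0 = 0 and S_n - S_(n-1) = 1 - 2 eta_n; recall that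
   Negz k is -(k+1).  See path_encoding0 and path_encodingB below. *)
Definition path_encoding (eta : config) (n : int) : int :=
  match n with
  | Posz k => \sum_(i < k) step eta i.+1%:Z
  | Negz k => - \sum_(i < k.+1) step eta (- i%:Z)
  end.

(* Inverse of path_encoding on path_space. *)
Definition config_of_path (S : int -> int) : config :=
  fun n => S n - S (n - 1) == -1.

Definition path_space : set (int -> int) :=
  [set S | S 0 = 0 /\ forall n, `|S n - S (n - 1)| = 1].

Lemma path_encoding0 eta : path_encoding eta 0 = 0.
Proof. exact: big_ord0. Qed.

Lemma path_encodingB eta n :
  path_encoding eta n - path_encoding eta (n - 1) = step eta n.
Proof.
case: n => [[|k]|k].
- by rewrite path_encoding0 /= big_ord_recl big_ord0 addr0 oppr0 sub0r opprK.
- rewrite (_ : Posz k.+1 - 1 = Posz k); last by rewrite intS addrAC subrr add0r.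
  by rewrite /= big_ord_recr /= addrAC subrr add0r.
- rewrite (_ : Negz k - 1 = Negz k.+1); last first.
    by rewrite !NegzE (intS k.+1) opprD addrC.
  by rewrite [path_encoding]lock -lock /= [X in _ - - X]big_ord_recr /= opprK
    addrA addNr add0r -NegzE.
Qed.

Lemma path_encoding_space eta : path_space (path_encoding eta).
Proof.
split; first exact: path_encoding0.
by move=> n; rewrite path_encodingB /step; case: (eta n).
Qed.

Lemma path_encodingK : cancel path_encoding config_of_path.
Proof.
move=> eta; apply/funext => n; rewrite /config_of_path path_encodingB /step.
by case: (eta n).
Qed.

Lemma config_of_pathK S : path_space S -> path_encoding (config_of_path S) = S.
Proof.
move=> [SO SB]; set P := path_encoding _.
have PB n : P n - P (n - 1) = S n - S (n - 1).
  rewrite path_encodingB /step /config_of_path.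
  have /eqP := SB n; rewrite eqr_norml ler01 andbT => /orP[]/eqP -> //.
have PS (k : nat) : P k%:Z = S k%:Z /\ P (- k%:Z) = S (- k%:Z).
  elim: k => [|k [IH1 IH2]]; first by rewrite oppr0 SO /P path_encoding0.
  split.
    have := PB k.+1%:Z.
    by rewrite (_ : k.+1%:Z - 1 = k) ?IH1 ?intS 1?addrAC ?subrr ?add0r// => /addIr.
  have := PB (- k%:Z); rewrite IH2 => /addrI /oppr_inj.
  by rewrite (_ : - k%:Z - 1 = - k.+1%:Z) // intS opprD addrC.
apply/funext => -[k|k]; first exact: (PS k).1.
by rewrite NegzE; exact: (PS k.+1).2.
Qed.

Section pitman.
Variable R : realType.
Implicit Types (S : int -> int) (n : int).
Local Open Scope ereal_scope.

Definition to_ereal (z : int) : \bar R := (z%:~R)%:E.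

(* M_n and I_n. *)
Definition past_sup S n : \bar R :=
  ereal_sup [set to_ereal (S m) | m in [set m : int | (m <= n)%R]].
Definition future_inf S n : \bar R :=
  ereal_inf [set to_ereal (S m) | m in [set m : int | (n <= m)%R]].

(* Left inverse of to_ereal; junk elsewhere. *)
Definition of_ereal (x : \bar R) : int := Num.floor (fine x).

Lemma to_erealK : cancel to_ereal of_ereal.
Proof. by move=> z; rewrite /of_ereal /= intrKfloor. Qed.

(* TS and T^{-1}S are total here, but meaningful only under the
   corresponding well-definedness condition: then all the past_sup S n
   (resp. future_inf S n) are finite and integer-valued, so of_ereal only
   changes the type. *)
Definition T_defined S := past_sup S 0 < +oo.
Definition Tpath S n : int :=
  of_ereal (2%:E * past_sup S n - to_ereal (S n) - 2%:E * past_sup S 0).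

Definition Tinv_defined S := -oo < future_inf S 0.
Definition Tinv_path S n : int :=
  of_ereal (2%:E * future_inf S n - to_ereal (S n) - 2%:E * future_inf S 0).

Definition Tconfig (eta : config) : config :=
  config_of_path (Tpath (path_encoding eta)).

Definition Srev : set (int -> int) :=
  [set S | path_space S /\
    [/\ T_defined S, Tinv_defined S,
        Tinv_defined (Tpath S) & T_defined (Tinv_path S)] /\
    Tinv_path (Tpath S) = S /\ Tpath (Tinv_path S) = S].

(* The limits n -> +oo and n -> -oo over Z are taken along the sequences
   k |-> k and k |-> - k, k : nat. *)
Definition S_subcritical_plus : set (int -> int) :=
  [set S | path_space S /\ exists F : int -> R, {homo F : m n / (m < n)%R} /\
    ((S k%:Z)%:~R / F k%:Z : R)%R @[k --> \oo] --> (1 : R)%R].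

Definition S_subcritical_minus : set (int -> int) :=
  [set S | path_space S /\ exists F : int -> R, {homo F : m n / (m < n)%R} /\
    ((S (- k%:Z))%:~R / F (- k%:Z) : R)%R @[k --> \oo] --> (1 : R)%R].

(* past_sup S n - future_inf S n is never of the form oo - oo, since
   future_inf S n <= S n <= past_sup S n.  If limsup - liminf
   is of this form then its value is -oo by convention, so that the equality
   with K fails. *)
Definition S_critical_plus : set (int -> int) :=
  [set S | path_space S /\ exists K : nat, (0 < K)%N /\
    ereal_sup [set past_sup S n - future_inf S n | n in [set: int]] = to_ereal K /\
    limn_esup (fun k : nat => to_ereal (S k%:Z))
      - limn_einf (fun k : nat => to_ereal (S k%:Z)) = to_ereal K].

Definition S_critical_minus : set (int -> int) :=
  [set S | path_space S /\ exists K : nat, (0 < K)%N /\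
    ereal_sup [set past_sup S n - future_inf S n | n in [set: int]] = to_ereal K /\
    limn_esup (fun k : nat => to_ereal (S (- k%:Z)%R))
      - limn_einf (fun k : nat => to_ereal (S (- k%:Z)%R)) = to_ereal K].

Definition S_subcritical := S_subcritical_minus `&` S_subcritical_plus.
Definition S_critical := S_critical_minus `&` S_critical_plus.

End pitman.

(* X and Y have the same law under P. *)
Definition eq_dist (d d' : measure_display) (Omega : measurableType d)
    (E : measurableType d') (R : realType) (P : probability Omega R)
    (X Y : Omega -> E) :=
  forall A : set E, measurable A -> pushforward P X A = pushforward P Y A.

(* Main.v *)
(** Write [M] for the past maximum of the path [S], [W = M - S] for the
    carrier, and [A_n] for the event that [S] has a strict record at [n].

    Density.  The pattern "10" occurs at [(n, n + 1)] in [eta] exactly when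
    "01" does in [T eta], so stationarity makes [P(eta_n = 1)] independent of
    [n].  The events [A_n], [eta_n = 1] and [(T eta)_n = 1] form a partition,
    whence [P(A_n) = 1 - 2 rho].  Both facts persist on every [T]-invariant
    event.

    Critical part.  The events that [S] is bounded above at [+oo], and that [S]
    does not tend to [-oo] at [-oo], are [T]-invariant.  On them [A_n] occurs
    only finitely often in one direction; as [P(A_n)] does not depend on [n],
    it vanishes, so [M] is constant and [T S = - S].  The same holds for [T S],
    so [S] oscillates for ever between two values.

    Subcritical part.  A carrier load [w] at a site can be followed through
    time: backwards it moves to the left, forwards to the right, and the level
    of [M] at its position changes by [w] at each step.  A load comparable to
    [|M_n - M_0|] therefore crosses the origin within a bounded number of
    steps, which is impossible when [|M_n - M_0|] exceeds the loads seen at the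
    origin during these steps.  Hence [W_n = o(M_n)] at both ends, and [F] can
    be taken to be [M] plus a bounded strictly increasing function. *)
Require Import Defs.
From mathcomp Require Import all_boot all_order all_algebra.
From mathcomp Require Import all_classical all_reals all_analysis.
From mathcomp Require Import zify lra.

Import Order.TTheory GRing.Theory Num.Theory.
Import numFieldNormedType.Exports.

Local Open Scope classical_set_scope.
Local Open Scope ring_scope.

(** * Pitman's transformation of integer paths *)

(* When the maximum does not exist, [xget] defaults to [n] and the value is [S n]. *)
Definition past_max (S : int -> int) (n : int) : int :=
  S (xget n [set l | l <= n /\ forall m : int, m <= n -> S m <= S l]).

Definition pitman (S : int -> int) (n : int) : int :=
  2 * past_max S n - S n - 2 * past_max S 0.

Definition carrier (S : int -> int) (n : int) : int := past_max S n - S n.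

Definition bounded_past (S : int -> int) := exists K, forall m : int, m <= 0 -> S m <= K.

Definition recurrent (S : int -> int) :=
  forall l n : int, l <= n -> exists m : int, n <= m /\ S l <= S m.

(* For paths with [bounded_past] and the third condition, [recurrent] says that
   the limsup at [+oo] is the supremum, i.e. [T^-1 T S = S]. *)
Definition good (S : int -> int) :=
  [/\ path_space S, bounded_past S, exists K, forall m : int, 0 <= m -> K <= S m
    & recurrent S].

Definition record (S : int -> int) (n : int) := forall l : int, l < n -> S l < S n.

Lemma int_set_max (Q : int -> Prop) (x0 K : int) :
  Q x0 -> (forall x, Q x -> x <= K) -> exists x, Q x /\ forall y, Q y -> y <= x.
Proof.
move=> Qx0 QK.
have [k x0k] : exists k : nat, K - x0 <= k%:Z by exists `|K - x0|%N; lia.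
elim: k x0 Qx0 x0k => [|k IH] x0 Qx0 x0k.
  by exists x0; split=> // y /QK; lia.
have [[y [Qy x0y]]|h] := pselect (exists y, Q y /\ x0 < y); first by apply: (IH y) => //; lia.
exists x0; split=> // y Qy; rewrite leNgt; apply/negP => ?; apply: h; by exists y.
Qed.

Lemma norm_int_eq1 (x : int) : `|x| = 1 <-> x = 1 \/ x = -1.
Proof.
split=> [|[]->//] /eqP; rewrite eqr_norml ler01 andbT => /orP[]/eqP; by [left|right].
Qed.

Lemma path_spaceP (S : int -> int) : path_space S <->
  S 0 = 0 /\ forall n, S n = S (n - 1) + 1 \/ S n = S (n - 1) - 1.
Proof.
split=> [[S0 S1]|[S0 S1]]; split=> //.
  move=> n; have : S n - S (n - 1) = 1 \/ S n - S (n - 1) = -1 := (norm_int_eq1 _).1 (S1 n).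
  by lia.
suff: forall n : int, S n - S (n - 1) = 1 \/ S n - S (n - 1) = -1.
  by move=> Sn n; exact/norm_int_eq1/Sn.
by move=> n; have := S1 n; lia.
Qed.

Section path.
Variable S : int -> int.
Hypothesis pS : path_space S.

Let path0 : S 0 = 0. Proof. exact: pS.1. Qed.

Lemma path_step (n : int) : S n = S (n - 1) + 1 \/ S n = S (n - 1) - 1.
Proof. exact: ((path_spaceP S).1 pS).2. Qed.

Lemma path_lipschitz (m : int) (k : nat) : S (m + k%:Z) <= S m + k%:Z.
Proof.
elim: k => [|k IH]; first by rewrite addr0; lia.
have := path_step (m + k.+1%:Z); rewrite (_ : _ - 1 = m + k%:Z); lia.
Qed.

Hypothesis bS : bounded_past S.

Lemma past_maxP (n : int) : (forall m : int, m <= n -> S m <= past_max S n) /\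
  exists l : int, l <= n /\ S l = past_max S n.
Proof.
rewrite /past_max; case: xgetP => [l _ [ln lmax]|none].
  by split=> //; exists l.
have [K SK] := bS.
(* [|K|] bounds the path left of the origin, and unit steps from [S 0 = 0] bound it by [|n|] between
   the origin and [n]. *)
have [//|//|_ [[l [ln ->]] lmax]] :=
    @int_set_max (fun x => exists l : int, l <= n /\ x = S l) (S n) (`|K| + `|n|).
- by exists n.
- move=> _ [l [ln ->]]; have [l0|l0] := leP l 0; first by have := SK l l0; lia.
  have := path_lipschitz 0 `|l|%N; rewrite path0 add0r.
  by rewrite gez0_abs; lia.
- exfalso; apply: (none l); split=> // m mn; apply: lmax; by exists m.
Qed.

Lemma past_max_ub (m n : int) : m <= n -> S m <= past_max S n.
Proof. exact: (past_maxP n).1. Qed.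

Lemma past_max_att (n : int) : exists l : int, l <= n /\ S l = past_max S n.
Proof. exact: (past_maxP n).2. Qed.

Lemma past_max_le (m n : int) : m <= n -> past_max S m <= past_max S n.
Proof. by move=> mn; have [l [lm <-]] := past_max_att m; apply: past_max_ub; lia. Qed.

(** A site attaining the maximum up to [n] either lies before [n], and the maximum is unchanged, or
    is [n] itself, and the unit step leaves only these two cases. *)
Lemma past_max_step (n : int) :
  (past_max S n = past_max S (n - 1) /\ S n <= past_max S (n - 1)) \/
  (past_max S n = past_max S (n - 1) + 1 /\ S n = past_max S n /\ S (n - 1) = past_max S (n - 1)).
Proof.
have := past_max_ub n n (lexx _); have := @past_max_ub (n - 1) (n - 1) (lexx _).
have := @past_max_le (n - 1) n; have := path_step n.
have [l [ln <-]] := past_max_att n; have [->|lNn] := eqVneq l n; first lia.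
by have := @past_max_ub l (n - 1); lia.
Qed.

Lemma carrier_ge0 (n : int) : 0 <= carrier S n.
Proof. by have := past_max_ub n n (lexx _); rewrite /carrier; lia. Qed.

Lemma recordP (n : int) : record S n <-> past_max S n = past_max S (n - 1) + 1.
Proof.
split=> [rn|pn l ln].
  case: (past_max_step n) => [[pE Sn]|[//]].
  have [l [ln Sl]] := past_max_att (n - 1); have := rn l; lia.
by have := @past_max_ub l (n - 1); have := past_max_step n; lia.
Qed.

Lemma no_record_past_max : (forall n, ~ record S n) -> forall n, past_max S n = past_max S 0.
Proof.
move=> nr.
have pE n : past_max S n = past_max S (n - 1).
  by case: (past_max_step n) => [[]//|[/recordP/nr]].
have pS' (k : nat) n : past_max S (n + k%:Z) = past_max S n.
  elim: k => [|k IH]; first by rewrite addr0.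
  by rewrite pE -IH; congr (past_max S _); lia.
move=> n; have [n0|n0] := leP 0 n.
  by rewrite -(pS' `|n|%N 0); congr (past_max S _); lia.
by rewrite -(pS' `|n|%N n); congr (past_max S _); lia.
Qed.

Lemma pitman_path_space : path_space (pitman S).
Proof.
apply/path_spaceP; split; first by rewrite /pitman path0; lia.
by move=> n; rewrite /pitman; have := path_step n; have := past_max_step n; lia.
Qed.

(** The box-ball rule: a particle is dropped at [n] exactly when the site is empty and the carrier
    arrives there nonempty. *)
Lemma pitman_down (n : int) : pitman S n - pitman S (n - 1) = -1 <->
  S n = S (n - 1) + 1 /\ exists l : int, l <= n - 1 /\ S (n - 1) < S l.
Proof.
rewrite /pitman; split=> [TSn|[Sn [l [ln Sl]]]].
  have ps := past_max_step n; have st := path_step n.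
  split; first lia.
  have [l [ln Sl]] := past_max_att (n - 1); exists l; split=> //.
  by have := past_max_ub (n - 1) (n - 1) (lexx _); lia.
have := @past_max_ub l (n - 1); have := past_max_step n; lia.
Qed.

(** Since [2 M_n - S_n >= M_n >= M_m]. With [pitman_future_att], this identifies the future minimum
    of [T S] with the past maximum of [S], up to a constant. *)
Lemma pitman_future_ge (m n : int) : m <= n -> past_max S m - 2 * past_max S 0 <= pitman S n.
Proof.
by move=> mn; have := @past_max_le m n; have := past_max_ub n n (lexx _); rewrite /pitman; lia.
Qed.

Hypothesis rS : recurrent S.

(** Equality holds at a site [m >= n] where [S m] and [past_max S m] both equal [past_max S n];
    recurrence supplies a return to that level. *)
Lemma pitman_future_att (n : int) :
  exists m : int, n <= m /\ pitman S m = past_max S n - 2 * past_max S 0.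
Proof.
(* Walking back from the return, one reaches a site that touches the old maximum before it is
   exceeded; the disjunction is what survives each step back. *)
have rec (d : nat) : past_max S n <= S (n + d%:Z) \/ past_max S n < past_max S (n + d%:Z) ->
    exists m : int, [/\ n <= m, S m = past_max S n & past_max S m = past_max S n].
  elim: d => [|d IH].
    rewrite addr0 => h; exists n; split=> //.
    by have := past_max_ub n n (lexx _); lia.
  have := past_max_step (n + d.+1%:Z); rewrite (_ : _ - 1 = n + d%:Z); last lia.
  have := @past_max_le n (n + d%:Z).
  move=> h1 [[pE Sle]|[h2 [h3 h4]]] h; last by apply: IH; lia.
  have [h5|h5] := ltP (past_max S n) (past_max S (n + d%:Z)); first by apply: IH; right.
  by exists (n + d.+1%:Z); split; lia.
have [l [ln Sl]] := past_max_att n.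
have [m [nm Sm]] := rS _ _ ln.
have [|m' [nm' Sm' pm']] := rec `|m - n|%N.
  by left; rewrite (_ : _ + _ = m) -?Sl//; lia.
by exists m'; split=> //; rewrite /pitman; lia.
Qed.

End path.

(** * Following a carrier load through time *)

Section step.
Variable S : int -> int.
Hypotheses (gS : good S) (gT : good (pitman S)).

(* The site [l] is where the path [T S] attains its past maximum at [n]: the
   future minimum of [T S] being the past maximum of [S], up to a constant, the
   drop of [T S] from [l] to [n] is at most the carrier of [S] at [l]. *)
Lemma backward_step (n w : int) : 0 <= n -> w <= carrier (pitman S) n ->
  [\/ w <= 2 * carrier S 0, w <= 2 * carrier (pitman S) 0
    | exists l : int, [/\ 0 <= l, w <= carrier S l
      & past_max S l - past_max S 0 <= past_max (pitman S) n - past_max (pitman S) 0 - w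
          + carrier S 0 + carrier (pitman S) 0]].
Proof.
have [pS bS _ rS] := gS; have [pT bT _ rT] := gT.
move=> n0 wn; have [l [ln Tl]] := @past_max_att _ pT bT n.
have := pitman_future_ge _ pS bS l n ln.
have := ((path_spaceP _).1 pT).1; have := ((path_spaceP _).1 pS).1.
have TlE : pitman S l = 2 * past_max S l - S l - 2 * past_max S 0 by [].
rewrite /carrier in wn *.
have [l0|l0] := leP 0 l.
  move=> *; apply: Or33; exists l; split; lia.
(* If [l] is left of the origin, [w] is at most the sum of the two carriers at the origin, where
   both paths vanish; one of them is then at least [w / 2]. *)
have := @past_max_ub _ pT bT l 0; have := pitman_future_ge _ pS bS 0 n n0.
move=> h1 h2 h3 h4 h5.
have [?|?] := leP w (2 * pitman S l); first by apply: Or32; lia.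
by apply: Or31; lia.
Qed.

(** Here [m] is where [T S] attains its minimum after [n]; the drop of [T S] from [n] to [m] equals
    the carrier of [S] at [n]. *)
Lemma forward_step (n w : int) : n <= 0 -> w <= carrier S n ->
  [\/ w <= 2 * carrier S 0, w <= 2 * carrier (pitman S) 0
    | exists m : int, [/\ m <= 0, w <= carrier (pitman S) m
      & past_max (pitman S) 0 - past_max (pitman S) m <= past_max S 0 - past_max S n - w
          + carrier S 0 + carrier (pitman S) 0]].
Proof.
have [pS bS _ rS] := gS; have [pT bT _ rT] := gT.
move=> n0 wn; have [m [nm Tm]] := pitman_future_att _ pS bS rS n.
have := @past_max_ub _ pT bT n m nm.
have := ((path_spaceP _).1 pT).1; have := ((path_spaceP _).1 pS).1.
have TnE : pitman S n = 2 * past_max S n - S n - 2 * past_max S 0 by [].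
rewrite /carrier in wn *.
have [m0|m0] := leP m 0.
  move=> *; apply: Or33; exists m; split; lia.
have := @past_max_ub _ pT bT n 0 n0; have h6 : 0 <= m by lia.
have := pitman_future_ge _ pS bS 0 m h6.
move=> h1 h2 h3 h4 h5.
have [?|?] := leP w (2 * pitman S n); first by apply: Or32; lia.
by apply: Or31; lia.
Qed.

End step.

(** While the carriers at the origin stay below [w / 4], each [backward_step] lowers the height of
    the maximum above its value at [0] by more than [w / 2]. A height below [J * w / 2] would turn
    negative within [J] steps, which is impossible right of the origin. *)
Lemma backward_trace (J : nat) S (n w : int) :
  (forall j, (j <= J)%N -> good (iter j pitman S)) -> 0 <= n ->
  w <= carrier (iter J pitman S) n ->
  2 * (past_max (iter J pitman S) n - past_max (iter J pitman S) 0) < J%:Z * w ->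
  exists j, (j <= J)%N /\ w <= 4 * carrier (iter j pitman S) 0.
Proof.
elim: J n => [|J IH] n gS n0 wn D.
  by have [pS bS _ _] := gS 0%N isT; have := past_max_le _ pS bS 0 n n0;
    move: D; rewrite mul0r; lia.
have gJ := gS J (leqnSn J); have gJ1 := gS J.+1 (leqnn _).
have [pJ bJ _ _] := gJ; have [pJ1 bJ1 _ _] := gJ1.
have c1 := carrier_ge0 _ pJ bJ 0; have c2 := carrier_ge0 _ pJ1 bJ1 0.
have [w1|w1] := leP w (4 * carrier (iter J pitman S) 0); first by exists J.
have [w2|w2] := leP w (4 * carrier (iter J.+1 pitman S) 0); first by exists J.+1.
have [h|h|[l [l0 wl Dl]]] := backward_step _ gJ gJ1 _ _ n0 wn.
- lia.
- by move: h w2 c2; rewrite iterS; lia.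
- have [||j [jJ wj]] := IH l _ l0 wl.
  + by move=> j jJ; apply: gS; lia.
  + by move: D Dl w2 c2; rewrite iterS; nia.
  + by exists j; split=> //; lia.
Qed.

(** The same count left of the origin; [S] is generalized in the induction because each step
    replaces it by [pitman S]. *)
Lemma forward_trace (J : nat) S (n w : int) :
  (forall j, (j <= J)%N -> good (iter j pitman S)) -> n <= 0 ->
  w <= carrier S n -> 2 * (past_max S 0 - past_max S n) < J%:Z * w ->
  exists j, (j <= J)%N /\ w <= 4 * carrier (iter j pitman S) 0.
Proof.
elim: J S n => [|J IH] S n gS n0 wn D.
  by have [pS bS _ _] := gS 0%N isT; have := past_max_le S pS bS n 0 n0;
    move: D; rewrite mul0r; lia.
have g0 := gS 0%N isT; have g1 := gS 1%N isT.
have [p0 b0 _ _] := g0; have [p1 b1 _ _] := g1.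
have c1 := carrier_ge0 _ p0 b0 0; have c2 := carrier_ge0 _ p1 b1 0.
have [w1|w1] := leP w (4 * carrier S 0); first by exists 0%N.
have [w2|w2] := leP w (4 * carrier (pitman S) 0); first by exists 1%N.
rewrite /= in g0 g1 c1 c2.
have [h|h|[m [m0 wm Dm]]] := forward_step _ g0 g1 _ _ n0 wn.
- lia.
- lia.
- have [||j [jJ wj]] := IH (pitman S) m _ m0 wm.
  + by move=> j jJ; rewrite -iterSr; apply: gS; lia.
  + by nia.
  + by exists j.+1; split=> //; rewrite iterSr.
Qed.

(** * Comparison with extended-real suprema and infima *)

(** Reversing both axes exchanges future infima with past suprema, so that the facts on [past_max]
    transfer to [future_min]. *)
Definition reflect_path (S : int -> int) (n : int) : int := - S (- n).

Lemma reflect_path_space {S} : path_space S -> path_space (reflect_path S).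
Proof.
move=> /path_spaceP[S0 S1]; apply/path_spaceP; rewrite /reflect_path oppr0 S0.
split=> // n; have := S1 (1 - n).
by rewrite (_ : 1 - n - 1 = - n) 1?(_ : - (n - 1) = 1 - n); lia.
Qed.

Definition future_min (S : int -> int) (n : int) : int := - past_max (reflect_path S) (- n).

Definition bounded_future (S : int -> int) :=
  exists K : int, forall m : int, 0 <= m -> K <= S m.

Lemma reflect_bounded S : bounded_past (reflect_path S) <-> bounded_future S.
Proof.
split=> [[K SK]|[K SK]]; exists (- K) => m m0.
  by have := SK (- m); rewrite /reflect_path opprK; lia.
by rewrite /reflect_path; have := SK (- m); lia.
Qed.

Section future_min.
Variable S : int -> int.
Hypotheses (pS : path_space S) (bS : bounded_future S).
Let prS := reflect_path_space pS.
Let brS := (reflect_bounded S).2 bS.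

Lemma future_min_lb (n m : int) : n <= m -> future_min S n <= S m.
Proof.
move=> nm; have nm' : - m <= - n by lia.
by have := past_max_ub _ prS brS _ _ nm'; rewrite /future_min /reflect_path opprK; lia.
Qed.

Lemma future_min_att (n : int) : exists m : int, n <= m /\ S m = future_min S n.
Proof.
have [l [ln Sl]] := past_max_att _ prS brS (- n); exists (- l); split; first lia.
by rewrite /future_min -Sl /reflect_path; lia.
Qed.

End future_min.

Section ereal.
Variable R : realType.

Lemma to_erealB (a b : int) : (to_ereal R a - to_ereal R b = to_ereal R (a - b))%E.
Proof. by rewrite /to_ereal intrB EFinB. Qed.

Lemma le_to_ereal (a b : int) : (to_ereal R a <= to_ereal R b)%E = (a <= b).
Proof. by rewrite /to_ereal lee_fin ler_int. Qed.

Lemma ereal_sup_int (I : Type) (D : set I) (f : I -> int) (a : int) :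
  (forall i, D i -> f i <= a) -> (exists i, D i /\ f i = a) ->
  ereal_sup [set to_ereal R (f i) | i in D] = to_ereal R a.
Proof.
move=> fa [i [Di fi]]; apply/eqP; rewrite eq_le; apply/andP; split.
  by apply: ge_ereal_sup => _ [j Dj <-]; rewrite le_to_ereal; exact: fa.
by apply: ereal_sup_ubound; exists i; rewrite ?fi.
Qed.

Lemma past_supE S n : path_space S -> bounded_past S ->
  past_sup R S n = to_ereal R (past_max S n).
Proof.
move=> pS bS; apply: ereal_sup_int; first by move=> m; apply: past_max_ub.
by have [l [ln Sl]] := past_max_att _ pS bS n; exists l.
Qed.

Lemma future_inf_reflect S n : future_inf R S n = (- past_sup R (reflect_path S) (- n)%R)%E.
Proof.
rewrite /future_inf /past_sup /ereal_inf; congr (- ereal_sup _)%E.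
apply/seteqP; split=> [_ [_ [m nm <-] <-]|_ [m nm <-]]; rewrite /=.
  exists (- m); first by rewrite /= lerN2.
  by rewrite /reflect_path opprK /to_ereal intrN EFinN.
exists (to_ereal R (S (- m))).
  by exists (- m) => //; rewrite /= lerNr.
by rewrite /reflect_path /to_ereal intrN EFinN.
Qed.

Lemma future_infE S n : path_space S -> bounded_future S ->
  future_inf R S n = to_ereal R (future_min S n).
Proof.
move=> /reflect_path_space pS /reflect_bounded bS.
by rewrite future_inf_reflect past_supE// /future_min /to_ereal intrN EFinN.
Qed.

Lemma T_definedP S : path_space S -> (T_defined R S <-> bounded_past S).
Proof.
move=> pS; split=> [|bS]; last by rewrite /T_defined past_supE// ltry.
rewrite /T_defined => h.
have lb m : m <= 0 -> (to_ereal R (S m) <= past_sup R S 0)%E.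
  by move=> m0; apply: ereal_sup_ubound; exists m.
move: h lb; case: past_sup => // [r|] _ lb.
  exists (Num.ceil r) => m /lb; rewrite lee_fin => h.
  by rewrite -(ler_int R); apply: le_trans h (ceil_ge _).
by have := lb 0 (lexx _).
Qed.

Lemma Tinv_definedP S : path_space S -> (Tinv_defined R S <-> bounded_future S).
Proof.
move=> pS; rewrite /Tinv_defined future_inf_reflect oppr0 ltNye_eq.
rewrite -reflect_bounded -T_definedP; last exact: reflect_path_space.
rewrite /T_defined; split.
  case: past_sup => [r||]//= _; exact: ltry.
have : (to_ereal R (reflect_path S 0) <= past_sup R (reflect_path S) 0)%E.
  by apply: ereal_sup_ubound; exists 0.
by case: past_sup.
Qed.

Lemma floor_int_comb (a b c : int) :
  Num.floor (2 * a%:~R - b%:~R - 2 * c%:~R : R) = 2 * a - b - 2 * c.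
Proof. by rewrite -[RHS](@intrKfloor R) !intrB !intrM. Qed.

Lemma TpathE S : path_space S -> bounded_past S -> Tpath R S = pitman S.
Proof.
move=> pS bS; apply/funext => n; rewrite /Tpath !past_supE// /to_ereal -!EFinM -!EFinB.
exact: floor_int_comb.
Qed.

(** The subtracted [+oo] makes the whole expression [-oo], and [fine] sends this to [0]. The junk
    value enters the measurability of [Tconfig] on all configurations. *)
Lemma Tpath_undefined S : path_space S -> ~ bounded_past S -> Tpath R S = cst 0.
Proof.
move=> pS nb; apply/funext => n; rewrite /Tpath.
have -> : past_sup R S 0 = +oo%E.
  by apply: contrapT => h; apply/nb/T_definedP; rewrite // /T_defined ltey; apply/eqP.
by rewrite (_ : (2 * +oo = +oo)%E) ?addeNy ?gt0_muley// /of_ereal /= floor0.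
Qed.

Lemma Tinv_pathE S : path_space S -> bounded_future S ->
  Tinv_path R S = fun n => 2 * future_min S n - S n - 2 * future_min S 0.
Proof.
move=> pS bS; apply/funext => n; rewrite /Tinv_path !future_infE// /to_ereal.
by rewrite -!EFinM -!EFinB; exact: floor_int_comb.
Qed.

(* [T^-1 T S = S] forces [inf_(m >= n) (2 M_m - S_m) = M_n] for all [n]: the
   difference does not depend on [n], and vanishes where [S] attains its
   maximum. *)
Lemma Srev_good S : Srev R S -> good S.
Proof.
move=> [pS [[/(T_definedP _ pS) bS /(Tinv_definedP _ pS) fS + _] [+ _]]].
have pT := pitman_path_space _ pS bS.
rewrite TpathE// => /(Tinv_definedP _ pT) fT TTS.
split=> // l n ln; apply: contrapT => /forallNP noret.
have {}noret m : n <= m -> S m < S l.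
  by move=> nm; rewrite ltNge; apply/negP => h; exact: (noret m).
have [p [pn Sp]] := past_max_att _ pS bS n.
have TTSk k : 2 * future_min (pitman S) k - pitman S k - 2 * future_min (pitman S) 0 = S k.
  by move: TTS; rewrite Tinv_pathE// => /(congr1 (@^~ k)).
have pp : past_max S p = S p.
  by have := past_max_le _ pS bS p n pn; have := past_max_ub _ pS bS p p (lexx _); lia.
(* The minimum after [p], attained at [r], fixes the additive constant of the inversion; then [m] is
   a site after [n] where [S] is back at [past_max S n]. *)
have [m [nm Tm]] := future_min_att _ pT fT n.
have [r [pr Tr]] := future_min_att _ pT fT p.
have h1 := pitman_future_ge _ pS bS p r pr.
have h2 := future_min_lb _ pT fT p p (lexx _).
have h3 := TTSk p; have h4 := TTSk n; have h5 := noret m nm.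
have h6 := past_max_ub _ pS bS l n ln; have h7 := past_max_le _ pS bS n m nm.
have h8 := past_max_ub _ pS bS m m (lexx _).
have E k : pitman S k = 2 * past_max S k - S k - 2 * past_max S 0 by [].
have := E m; have := E n; have := E p; have := E r; lia.
Qed.

End ereal.

(** * Behaviour of paths at the two ends *)

Section deterministic.
Implicit Types S : int -> int.

Definition bounded_right S := exists K : int, forall m : int, 0 <= m -> S m <= K.

(** The negation says that [S] tends to [-oo] at [-oo]. *)
Definition recurrent_left S :=
  exists K : int, forall n : int, exists m : int, m <= n /\ K <= S m.

Lemma bounded_right_pitman S : good S -> bounded_right S -> bounded_right (pitman S).
Proof.
move=> [pS bS [I SI] _] [K SK].
exists (2 * Num.max K (past_max S 0) - I - 2 * past_max S 0) => m m0.
have [l [lm Sl]] := past_max_att _ pS bS m; have := SI m m0; rewrite /pitman -Sl.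
have [l0|l0] := leP 0 l; first by have := SK l l0; lia.
by have := @past_max_ub _ pS bS l 0; lia.
Qed.

(** Returns to level [K] keep [past_max S n] at least [K] for every [n], and [pitman S n >= past_max
    S n - 2 * past_max S 0]. *)
Lemma recurrent_left_pitman S : good S -> recurrent_left S -> recurrent_left (pitman S).
Proof.
move=> [pS bS _ _] [K SK]; exists (K - 2 * past_max S 0) => n.
exists n; split=> //; have [m [mn Sm]] := SK n.
by have := @past_max_ub _ pS bS m n mn; have := @past_max_ub _ pS bS n n (lexx _);
  rewrite /pitman; lia.
Qed.

Lemma records_unbounded S : (forall n : int, exists m : int, n <= m /\ record S m) ->
  ~ bounded_right S.
Proof.
move=> rec [K SK]; have [n0 [n00 r0]] := rec 0.
suff [m [m0 Sm]] : exists m : int, 0 <= m /\ S n0 + (`|K - S n0| + 1) <= S m.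
  by have := SK m m0; lia.
have [k ->] : exists k : nat, `|K - S n0| + 1 = k%:Z by exists `|K - S n0|.+1%N; lia.
elim: k => [|k [m [m0 Sm]]]; first by exists n0; split=> //; lia.
have [m' [mm' r']] := rec (m + 1); exists m'; split; first lia.
by have := r' m; lia.
Qed.

(** Successive records towards the left descend by at least one, and the path stays below each of
    them on its left. *)
Lemma records_transient_left S : (forall n : int, exists m : int, m <= n /\ record S m) ->
  ~ recurrent_left S.
Proof.
move=> rec [K SK]; have [n0 [n00 r0]] := rec 0.
suff [m [rm Sm]] : exists m : int, record S m /\ S m <= S n0 - `|K - S n0|.
  by have [l [lm Sl]] := SK (m - 1); have := rm l; lia.
have [k ->] : exists k : nat, `|K - S n0| = k%:Z by exists `|K - S n0|%N; lia.
elim: k => [|k [m [rm Sm]]]; first by exists n0; split=> //; lia.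
have [m' [mm' r']] := rec (m - 1); exists m'; split=> //.
by have := rm m'; lia.
Qed.

End deterministic.

Definition oscillates (S : int -> int) (a b : int) :=
  [/\ forall n : int, a <= S n <= b,
      forall n : int, exists m : int, n <= m /\ S m = b,
      forall n : int, exists m : int, n <= m /\ S m = a,
      forall n : int, exists m : int, m <= n /\ S m = b
    & forall n : int, exists m : int, m <= n /\ S m = a].

(** As [pitman S = - S], the past maxima of the two paths give the two extreme levels, attained
    arbitrarily far left. Recurrence of [S] brings back the upper level on the right, that of
    [pitman S] the lower one. *)
Lemma no_record_oscillates S : good S -> good (pitman S) ->
  (forall n, ~ record S n) -> (forall n, ~ record (pitman S) n) ->
  exists a b : int, a < b /\ oscillates S a b.
Proof.
move=> [pS bS _ rS] [pT bT _ rT] nS nT.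
have pE := no_record_past_max _ pS bS nS; have tE := no_record_past_max _ pT bT nT.
have TS n : pitman S n = - S n by rewrite /pitman pE; lia.
have ub n : S n <= past_max S 0 by rewrite -(pE n); apply: past_max_ub.
have lb n : - S n <= past_max (pitman S) 0 by rewrite -TS -(tE n); apply: past_max_ub.
have bp n : exists m : int, m <= n /\ S m = past_max S 0.
  by have [l [ln Sl]] := past_max_att _ pS bS n; exists l; rewrite -(pE n).
have ap n : exists m : int, m <= n /\ S m = - past_max (pitman S) 0.
  have [l [ln Sl]] := past_max_att _ pT bT n; exists l; split=> //.
  by rewrite -(tE n) -Sl TS opprK.
exists (- past_max (pitman S) 0), (past_max S 0); split.
  suff ab (n : int) : - past_max (pitman S) 0 < past_max S 0 by exact: (ab 0).
  by have := path_step _ pS n; have := ub n; have := ub (n - 1); have := lb n;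
    have := lb (n - 1); lia.
split=> // n.
- by have := ub n; have := lb n; lia.
- have [l [ln Sl]] := bp n; have [m [nm Sm]] := rS _ _ ln.
  by exists m; split=> //; have := ub m; lia.
- have [l [ln Sl]] := ap n; have [m [nm Sm]] := rT _ _ ln.
  by exists m; split=> //; move: Sm; rewrite !TS; have := lb m; lia.
Qed.

(** * Critical and subcritical paths *)

Section classes.
Variable R : realType.

Lemma limn_esup_int (u : nat -> int) (b : int) :
  (forall k, u k <= b) -> (forall n, exists k, (n <= k)%N /\ u k = b) ->
  limn_esup (fun k => to_ereal R (u k)) = to_ereal R b.
Proof.
move=> ub io; apply/eqP; rewrite eq_le; apply/andP; split.
  apply: ereal_inf_lbound; exists setT; first exact: filterT.
  apply: ereal_sup_int => [i _|]; first exact: ub.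
  by have [k [_ uk]] := io 0%N; exists k.
apply: le_ereal_inf_tmp => _ [V [N _ NV] <-].
have [k [Nk <-]] := io N; apply: ereal_sup_ubound; exists k => //; exact: NV.
Qed.

Lemma limn_einf_int (u : nat -> int) (a : int) :
  (forall k, a <= u k) -> (forall n, exists k, (n <= k)%N /\ u k = a) ->
  limn_einf (fun k => to_ereal R (u k)) = to_ereal R a.
Proof.
move=> lb io.
rewrite (_ : (fun k => _) = -%E \o (fun k => to_ereal R (- u k))); last first.
  by apply/funext => k; rewrite /to_ereal /= intrN opprK.
rewrite limn_einfN (@limn_esup_int _ (- a)) ?/to_ereal ?intrN ?EFinN ?oppeK//.
  by move=> k; rewrite lerN2; exact: lb.
by move=> n; have [k [nk uk]] := io n; exists k; rewrite uk.
Qed.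

Lemma oscillates_critical S (a b : int) : path_space S -> a < b ->
  oscillates S a b -> S_critical R S.
Proof.
move=> pS ab [Sab rb ra lb la].
have bS : bounded_past S by exists b => m _; have := Sab m; lia.
have fS : bounded_future S by exists a => m _; have := Sab m; lia.
have pE n : past_max S n = b.
  have [m [mn Sm]] := lb n; have := @past_max_ub _ pS bS m n mn.
  by have [l [ln Sl]] := past_max_att _ pS bS n; have := Sab l; lia.
have fE n : future_min S n = a.
  have [m [nm Sm]] := ra n; have := future_min_lb _ pS fS n m nm.
  by have [l [ln Sl]] := future_min_att _ pS fS n; have := Sab l; lia.
have supE : ereal_sup [set (past_sup R S n - future_inf R S n)%E | n in [set: int]] =
    to_ereal R `|b - a|%N.
  have -> : [set (past_sup R S n - future_inf R S n)%E | n in [set: int]] =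
      [set to_ereal R (past_max S n - future_min S n) | n in [set: int]].
    by apply: eq_imagel => n _; rewrite past_supE// future_infE// to_erealB.
  apply: ereal_sup_int => [n _|]; first by rewrite pE fE; lia.
  by exists 0; split=> //; rewrite pE fE; lia.
have limE (u : nat -> int) : (forall k, a <= u k <= b) ->
    (forall n, exists k, (n <= k)%N /\ u k = b) ->
    (forall n, exists k, (n <= k)%N /\ u k = a) ->
    (limn_esup (fun k => to_ereal R (u k)) - limn_einf (fun k => to_ereal R (u k)) =
     to_ereal R `|b - a|%N)%E.
  move=> uab ub ua; rewrite (@limn_esup_int _ b)// ?(@limn_einf_int _ a)//.
  - by rewrite to_erealB; congr (to_ereal R _); lia.
  - by move=> k; case/andP: (uab k).
  - by move=> k; case/andP: (uab k).
split; (split; [by []|exists `|b - a|%N; split; [lia|split=> //; apply: limE => [k|n|n]]]).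
- exact: Sab.
- have [m [mn Sm]] := lb (- n%:Z); exists `|m|%N; split; first lia.
  by rewrite -Sm; congr (S _); lia.
- have [m [mn Sm]] := la (- n%:Z); exists `|m|%N; split; first lia.
  by rewrite -Sm; congr (S _); lia.
- exact: Sab.
- have [m [mn Sm]] := rb n%:Z; exists `|m|%N; split; first lia.
  by rewrite -Sm; congr (S _); lia.
- have [m [mn Sm]] := ra n%:Z; exists `|m|%N; split; first lia.
  by rewrite -Sm; congr (S _); lia.
Qed.

Lemma critical_bounded_right S : S_critical R S -> bounded_right S.
Proof.
move=> [_ [pS [K [_ [_]]]]]; set L := limn_esup _ => LK.
(* Were [L] equal to [+oo], the difference would be infinite whatever the liminf is. *)
have : (L < +oo)%E.
  rewrite ltey; apply/eqP => L_oo; move: LK; rewrite L_oo.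
  by case: limn_einf.
move=> /ereal_inf_lt[_ [V [N _ NV] <-]] Voo.
have VS k : (N <= k)%N -> (to_ereal R (S k) <= ereal_sup [set to_ereal R (S k%:Z) | k in V])%E.
  by move=> Nk; apply: ereal_sup_ubound; exists k => //; exact: NV.
move: Voo VS; case: ereal_sup => [r||]// _ VS; last by have := VS N (leqnn _).
(* [r] bounds the tail from [N] on; before [N], unit steps from [0] keep the path below [N]. *)
exists (Num.max N%:Z (Num.ceil r)) => m m0.
have -> : m = `|m|%N%:Z by lia.
have [Nm|mN] := leqP N `|m|%N.
  have := VS _ Nm; rewrite lee_fin => h; rewrite le_max; apply/orP; right.
  by rewrite -(ler_int R); apply: le_trans h (ceil_ge _).
have := path_lipschitz _ pS 0 `|m|%N.
by rewrite add0r ((path_spaceP S).1 pS).1 add0r le_max => h; apply/orP; left; lia.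
Qed.

(** A strictly increasing function from [-2] at [-oo] to [0] at [+oo]; adding it to [past_max] gives
    a strictly increasing normalization [F]. *)
Definition squash (n : int) : R :=
  match n with
  | Posz k => - (k.+1%:R)^-1
  | Negz k => (k.+2%:R)^-1 - 2
  end.

Let invn_itv (k : nat) : 0 <= (k.+1%:R : R)^-1 <= 1.
Proof. by rewrite invr_ge0 ler0n invf_le1 ?ler1n ?ltr0n. Qed.

Lemma squash_bounds n : -2 <= squash n <= 0.
Proof.
case: n => k /=; first have /andP[] := invn_itv k; last have /andP[] := invn_itv k.+1.
  by move: (_^-1) => x x0 x1; apply/andP; split; lra.
by move: (_^-1) => x x0 x1; apply/andP; split; lra.
Qed.

Lemma squash_lt : {homo squash : m n / m < n}.
Proof.
move=> [j|j] [k|k] //= jk.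
- by rewrite ltrN2 ltf_pV2 ?posrE ?ltr0n// ltr_nat; lia.
- have /andP[_] := invn_itv k.
  have : (j.+2%:R : R)^-1 <= 2^-1 by rewrite lef_pV2 ?posrE ?ltr0n// ler_nat.
  move: (j.+2%:R^-1) (k.+1%:R^-1) => x y; lra.
- by rewrite ltrD2r ltf_pV2 ?posrE ?ltr0n// ltr_nat; lia.
Qed.

(** The error is at most [(w + 2) / |f|], and [q * w <= 2 |f|] with [2 * q <= |f|] gives
    [q * (w + 2) <= 3 |f|]. Here [w] stands for the carrier, and [2] bounds [squash]. *)
Lemma ratio_close (e f s w d q : R) : 0 < e -> 0 < q -> 0 <= w ->
  `|f - s| <= w + 2 -> d <= 2 * `|f| -> q * w <= d -> 4 * q <= d -> 3 < e * q ->
  `|1 - s / f| < e.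
Proof.
move=> e0 q0 w0 fs df qw qd eq.
have f0 : 0 < `|f| by nra.
have fN0 : f != 0 by rewrite -normr_gt0.
rewrite (_ : 1 - s / f = (f - s) / f); last by rewrite mulrBl divff.
rewrite normrM normfV ltr_pdivrMr//.
apply: (le_lt_trans fs); rewrite -(ltr_pM2l q0).
nra.
Qed.

Let F (S : int -> int) (n : int) : R := (past_max S n)%:~R + squash n.

Let F_lt S : path_space S -> bounded_past S -> {homo F S : m n / m < n}.
Proof.
by move=> pS bS m n mn; rewrite ler_ltD ?squash_lt// ler_int past_max_le// ltW.
Qed.

(** Common to both ends: [D] is the distance of the past maximum from its value at [0], and [c]
    absorbs that value. *)
Lemma subcritical_of_carrier S (n : nat -> int) (D : int -> int) (c : int) :
  path_space S -> bounded_past S ->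
  (forall k, `|D (n k)| <= `|past_max S (n k)| + c) ->
  (forall K : int, \forall k \near \oo, K <= D (n k)) ->
  (forall q : nat, exists N : int, forall k, N <= D (n k) ->
     q%:Z * carrier S (n k) < D (n k)) ->
  ((S (n k))%:~R / F S (n k) : R)%R @[k --> \oo] --> (1 : R).
Proof.
move=> pS bS Dc D_oo DW; apply/cvgrPdist_lt => e e0.
have [q q0 eq] : exists2 q : nat, (0 < q)%N & 3 < e * q%:R.
  exists (Num.truncn (3 / e)).+1 => //.
  by rewrite mulrC -ltr_pdivrMr// truncnS_gt.
have [N qN] := DW q.
(* Since [|F| >= D - c - 2], the terms [2 |c| + 4] ensure [D <= 2 |F|]; the term [4 q] is the one in
   [ratio_close]. *)
have := D_oo (Num.max N (4 * q%:Z + `|c| * 2 + 4)); apply: filterS => k.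
rewrite ge_max => /andP[/qN DN DK].
have w0 := carrier_ge0 _ pS bS (n k).
have /andP[g1 g2] := squash_bounds (n k).
have h : `|D (n k)| <= `|past_max S (n k)| + c := Dc k.
have hR : (`|D (n k)| : int)%:~R <= (`|past_max S (n k)| + c)%:~R :> R by rewrite ler_int.
have h2R : (4 * q%:Z + `|c| * 2 + 4)%:~R <= (D (n k))%:~R :> R by rewrite ler_int.
have h3R : (q%:Z * carrier S (n k))%:~R < (D (n k))%:~R :> R by rewrite ltr_int.
have c0R : c%:~R <= (`|c| : int)%:~R :> R by rewrite ler_int ler_norm.
have c0 : 0 <= (`|c| : int)%:~R :> R by rewrite ler0z.
have wR : 0 <= (carrier S (n k))%:~R :> R by rewrite ler0z.
move: hR h2R h3R; rewrite !intrD !intrM !intr_norm => hR h2R h3R.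
have q0R : 0 < q%:R :> R by rewrite ltr0n.
have DD := ler_norm ((D (n k))%:~R : R).
have FF : `|(past_max S (n k))%:~R| - 2 <= `|F S (n k)|.
  rewrite /F; apply: le_trans (lerB_normD _ _).
  by rewrite lerD2l lerN2 ler_norml; apply/andP; split; lra.
apply: (@ratio_close e _ _ (carrier S (n k))%:~R (D (n k))%:~R q%:R) => //.
- rewrite /F /carrier intrB ler_norml; apply/andP; split; last by lra.
  by move: wR; rewrite /carrier intrB; lra.
- rewrite !intr_norm in c0 c0R. lra.
- lra.
- rewrite !intr_norm in c0 c0R. lra.
Qed.

Lemma subcritical_plus S : path_space S -> bounded_past S -> ~ bounded_right S ->
  (forall q : nat, exists N : int, forall n : int, 0 <= n ->
     N <= past_max S n - past_max S 0 -> q%:Z * carrier S n < past_max S n - past_max S 0) ->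
  S_subcritical_plus R S.
Proof.
move=> pS bS nb SW; split=> //; exists (F S); split; first exact: F_lt.
apply: (@subcritical_of_carrier _ (fun k => k%:Z)
  (fun m => past_max S m - past_max S 0) `|past_max S 0|).
- by [].
- by [].
- by move=> k; lia.
- move=> K; have [m [m0 Km]] : exists m : int, 0 <= m /\ K + past_max S 0 <= S m.
    apply: contrapT => /forallNP h; apply: nb; exists (K + past_max S 0) => m m0.
    by rewrite leNgt; apply/negP => Sm; apply: (h m); split=> //; exact: ltW.
  exists `|m|%N => // k /= mk; have mk' : m <= k%:Z by lia.
  by have := past_max_ub _ pS bS _ _ mk'; lia.
- by move=> q; have [N SN] := SW q; exists N => k; apply: SN.
Qed.

Lemma subcritical_minus S : path_space S -> bounded_past S -> ~ recurrent_left S ->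
  (forall q : nat, exists N : int, forall n : int, n <= 0 ->
     N <= past_max S 0 - past_max S n -> q%:Z * carrier S n < past_max S 0 - past_max S n) ->
  S_subcritical_minus R S.
Proof.
move=> pS bS nb SW; split=> //; exists (F S); split; first exact: F_lt.
apply: (@subcritical_of_carrier _ (fun k => - k%:Z)
  (fun m => past_max S 0 - past_max S m) `|past_max S 0|).
- by [].
- by [].
- by move=> k; lia.
- move=> K; have [n Kn] : exists n : int, forall m : int, m <= n -> S m < past_max S 0 - K.
    apply: contrapT => /forallNP h; apply: nb; exists (past_max S 0 - K) => n.
    have := h n; move=> /existsNP[m] /not_implyP[mn /negP]; rewrite -leNgt => Sm.
    by exists m.
  exists `|n|%N => // k /= nk; have [l [lk Sl]] := past_max_att _ pS bS (- k%:Z).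
  by have := Kn l; lia.
- by move=> q; have [N SN] := SW q; exists N => k; apply: SN; lia.
Qed.

End classes.

(** * Measurability *)

Section measurable_predicates.
Context {d : measure_display} {X : measurableType d}.

Lemma measurable_ex {I : countType} {A : I -> X -> Prop} :
  (forall i, measurable [set e | A i e]) -> measurable [set e | exists i, A i e].
Proof.
move=> mA; rewrite (_ : [set e | _] = \bigcup_i [set e | A i e]).
  exact: countable_bigcupT_measurable.
by apply/seteqP; split=> e /= [i]; [exists i|move=> _; exists i].
Qed.

Lemma measurable_not {A : X -> Prop} :
  measurable [set e | A e] -> measurable [set e | ~ A e].
Proof. exact: measurableC. Qed.

Lemma measurable_and {A B : X -> Prop} :
  measurable [set e | A e] -> measurable [set e | B e] -> measurable [set e | A e /\ B e].
Proof. exact: measurableI. Qed.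

Lemma measurable_or {A B : X -> Prop} :
  measurable [set e | A e] -> measurable [set e | B e] -> measurable [set e | A e \/ B e].
Proof. exact: measurableU. Qed.

Lemma measurable_all {I : countType} {A : I -> X -> Prop} :
  (forall i, measurable [set e | A i e]) -> measurable [set e | forall i, A i e].
Proof.
move=> mA; rewrite (_ : [set e | _] = [set e | ~ exists i, ~ A i e]).
  by apply/measurable_not/measurable_ex => i; exact: measurable_not.
apply/seteqP; split=> e /=; first by move=> Ae [i nA]; exact: (nA (Ae i)).
by move=> /forallNP h i; apply: contrapT; exact: h.
Qed.

Lemma measurable_const (c : Prop) : measurable [set _ : X | c].
Proof.
have [h|h] := pselect c; first by rewrite (_ : [set _ | _] = setT)// -subTset.
by rewrite (_ : [set _ | _] = set0)// -subset0.
Qed.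

Lemma measurable_imp {c : Prop} {A : X -> Prop} :
  (c -> measurable [set e | A e]) -> measurable [set e | c -> A e].
Proof.
move=> mA; have [h|h] := pselect c.
  rewrite (_ : [set e | _] = [set e | A e]); first exact: mA.
  by apply/seteqP; split=> e /= ; [exact|move=> ? _].
by rewrite (_ : [set _ | _] = setT)// -subTset => e _ /h.
Qed.

(** Measurability for the discrete sigma-algebra on [int]; any operation on the values preserves
    it. *)
Definition int_measurable (f : X -> int) := forall Q : int -> Prop, measurable [set e | Q (f e)].

Lemma measurable_rel2 {f g : X -> int} (r : int -> int -> Prop) :
  int_measurable f -> int_measurable g -> measurable [set e | r (f e) (g e)].
Proof.
move=> mf mg.
rewrite (_ : [set e | _] = [set e | exists a, exists b, f e = a /\ g e = b /\ r a b]).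
  apply: measurable_ex => a; apply: measurable_ex => b; apply: measurable_and.
    exact: (mf (fun x => x = a)).
  by apply: measurable_and; [exact: (mg (fun x => x = b))|exact: measurable_const].
by apply/seteqP; split=> e /=; [exists (f e), (g e)|move=> [a [b [<- [<-]]]]].
Qed.

Lemma int_measurable2 {f g : X -> int} (h : int -> int -> int) :
  int_measurable f -> int_measurable g -> int_measurable (fun e => h (f e) (g e)).
Proof. by move=> mf mg Q; exact: (measurable_rel2 (fun a b => Q (h a b))). Qed.

Lemma int_measurable_sum (n : nat) (f : nat -> X -> int) :
  (forall i, int_measurable (f i)) -> int_measurable (fun e => \sum_(i < n) f i e).
Proof.
move=> mf; elim: n => [|n IH].
  by move=> Q; under eq_set do rewrite big_ord0; exact: measurable_const.
move=> Q; under eq_set do rewrite big_ord_recr.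
exact: (int_measurable2 (fun a b => a + b) IH (mf n)).
Qed.

End measurable_predicates.

Lemma measurable_coord (n : int) (b : bool) : measurable [set e : config | e n = b].
Proof.
apply: sub_sigma_algebra; exists n => //; exists [set b] => //.
by rewrite setTI.
Qed.

Lemma int_measurable_path (n : int) : int_measurable (fun e => path_encoding e n).
Proof.
have ms m : int_measurable (fun e => step e m).
  move=> Q; rewrite (_ : [set e | _] = [set e | e m = true /\ Q (-1) \/ e m = false /\ Q 1]).
    apply: measurable_or; apply: measurable_and;
      (exact: measurable_coord || exact: measurable_const).
  apply/seteqP; split=> e /=; rewrite /step; case: (e m); first by left.
  - by right.
  - by case=> -[].
  - by case=> -[].
case: n => k; first exact: (int_measurable_sum k (fun i e => step e i.+1%:Z)).
move=> Q.
exact: (int_measurable_sum k.+1 (fun i e => step e (- i%:Z)) (fun i => ms (- i%:Z))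
  (fun z => Q (- z))).
Qed.

(** The value is either an attained maximum or, when there is none, the default [path_encoding e n];
    both cases are countable combinations of coordinate events. *)
Lemma int_measurable_past_max (n : int) : int_measurable (fun e => past_max (path_encoding e) n).
Proof.
pose ismax (e : config) (z : int) := (exists l : int, l <= n /\ path_encoding e l = z) /\
  forall m : int, m <= n -> path_encoding e m <= z.
have mi z : measurable [set e | ismax e z].
  apply: measurable_and.
    apply: measurable_ex => l; apply: measurable_and; first exact: measurable_const.
    exact: (int_measurable_path l (fun x => x = z)).
  apply: measurable_all => m; apply: measurable_imp => _.
  exact: (int_measurable_path m (fun x => x <= z)).
move=> Q; rewrite (_ : [set e | _] = [set e | exists z, Q z /\
    (ismax e z \/ (~ exists y, ismax e y) /\ path_encoding e n = z)]).
  apply: measurable_ex => z; apply: measurable_and; first exact: measurable_const.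
  apply: measurable_or => //; apply: measurable_and.
    by apply/measurable_not/measurable_ex.
  exact: (int_measurable_path n (fun x => x = z)).
have ismax_uniq e y z : ismax e y -> ismax e z -> y = z.
  move=> [[l [ln <-]] lmax] [[k [kn <-]] kmax].
  by have := lmax k kn; have := kmax l ln; lia.
apply/seteqP; split=> e /=; rewrite /past_max; case: xgetP => [l _ [ln lmax]|none].
- by move=> Ql; exists (path_encoding e l); split=> //; left; split=> //; exists l.
- move=> Qn; exists (path_encoding e n); split=> //; right; split=> //.
  move=> [_ [[l [ln <-]] lmax]]; exact: (none l).
- have il : ismax e (path_encoding e l) by split=> //; exists l.
  move=> [z [Qz [iz|[]]]]; last by case; exists (path_encoding e l).
  by rewrite (ismax_uniq _ _ _ il iz).
- move=> [z [Qz [[[l [ln lz]] lmax]|[_ ->]//]]].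
  by exfalso; apply: (none l); split=> // m mn; rewrite lz; exact: lmax.
Qed.

Local Notation path := path_encoding.

Lemma measurable_le (f g : config -> int) : int_measurable f -> int_measurable g ->
  measurable [set e | f e <= g e].
Proof. exact: (measurable_rel2 (fun a b => a <= b)). Qed.

Lemma measurable_bounded_past : measurable [set e | bounded_past (path e)].
Proof.
apply: measurable_ex => K; apply: measurable_all => m; apply: measurable_imp => _.
exact: (int_measurable_path m (fun x => x <= K)).
Qed.

Lemma measurable_bounded_right : measurable [set e | bounded_right (path e)].
Proof.
apply: measurable_ex => K; apply: measurable_all => m; apply: measurable_imp => _.
exact: (int_measurable_path m (fun x => x <= K)).
Qed.

Lemma measurable_recurrent_left : measurable [set e | recurrent_left (path e)].
Proof.
apply: measurable_ex => K; apply: measurable_all => n; apply: measurable_ex => m.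
apply: measurable_and; first exact: measurable_const.
exact: (int_measurable_path m (fun x => K <= x)).
Qed.

Lemma measurable_good : measurable [set e | good (path e)].
Proof.
rewrite (_ : [set e | _] = [set e | bounded_past (path e) /\
    ((exists K : int, forall m : int, 0 <= m -> K <= path e m) /\ recurrent (path e))]).
  apply: measurable_and; first exact: measurable_bounded_past.
  apply: measurable_and.
    apply: measurable_ex => K; apply: measurable_all => m; apply: measurable_imp => _.
    exact: (int_measurable_path m (fun x => K <= x)).
  apply: measurable_all => l; apply: measurable_all => n; apply: measurable_imp => _.
  apply: measurable_ex => m; apply: measurable_and; first exact: measurable_const.
  exact: measurable_le (int_measurable_path l) (int_measurable_path m).
apply/seteqP; split=> e /=; first by move=> [].
by move=> [? [? ?]]; split=> //; exact: path_encoding_space.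
Qed.

Lemma measurable_record (n : int) : measurable [set e | record (path e) n].
Proof.
apply: measurable_all => l; apply: measurable_imp => _.
exact: (measurable_rel2 (fun a b => a < b)) (int_measurable_path l) (int_measurable_path n).
Qed.

(** The estimate [W = o(M)] at the right end, at precision [1 / q]. *)
Definition carrier_sublinear (S : int -> int) (q : nat) :=
  exists N : int, forall n : int, 0 <= n -> N <= past_max S n - past_max S 0 ->
    q%:Z * carrier S n < past_max S n - past_max S 0.

Lemma measurable_carrier_sublinear q : measurable [set e | carrier_sublinear (path e) q].
Proof.
have mD n : int_measurable (fun e => past_max (path e) n - past_max (path e) 0).
  exact: (int_measurable2 (fun a b => a - b)
    (int_measurable_past_max n) (int_measurable_past_max 0)).
have mW n : int_measurable (fun e => carrier (path e) n).
  exact: (int_measurable2 (fun a b => a - b) (int_measurable_past_max n) (int_measurable_path n)).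
apply: measurable_ex => N; apply: measurable_all => n; apply: measurable_imp => _.
rewrite (_ : [set e | _] = [set e | ~ (N <= past_max (path e) n - past_max (path e) 0) \/
    q%:Z * carrier (path e) n < past_max (path e) n - past_max (path e) 0]).
  apply: measurable_or; first by apply: measurable_not; exact: (mD n (fun x => N <= x)).
  exact: (measurable_rel2 (fun a b => q%:Z * a < b) (mW n) (mD n)).
apply/seteqP; split=> e /=; last by case.
by move=> h; have [?|?] := pselect (N <= past_max (path e) n - past_max (path e) 0);
  [right; exact: h|left].
Qed.

(** * The transformation of configurations *)

Section Tconfig.
Variable R : realType.
Local Notation T := (Tconfig R).

Lemma path_config (e : config) (n : int) :
  path e n = path e (n - 1) + (if e n then -1 else 1).
Proof.
have : path e n - path e (n - 1) = if e n then -1 else 1 :> int.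
  by rewrite path_encodingB /step; case: (e n).
by case: (e n); lia.
Qed.

Lemma path_Tconfig e : bounded_past (path e) -> path (T e) = pitman (path e).
Proof.
move=> be; have pe := path_encoding_space e.
rewrite /Tconfig TpathE// config_of_pathK//; exact: pitman_path_space.
Qed.

Lemma TconfigP e n : T e n = true <-> bounded_past (path e) /\ e n = false /\
  exists l : int, l <= n - 1 /\ path e (n - 1) < path e l.
Proof.
have pe := path_encoding_space e; rewrite /Tconfig /config_of_path.
have [be|nbe] := pselect (bounded_past (path e)); last first.
  (* The junk path is constant, hence carries no particle. *)
  by rewrite Tpath_undefined//= subr0; split=> [|[]].
rewrite TpathE//; have := pitman_down _ pe be n; have := path_config e n.
move=> en [h1 h2]; split=> [/eqP/h1[en' hl]|[_ [en' hl]]].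
  by split=> //; split=> //; move: en; case: (e n) => //; lia.
by apply/eqP/h2; split=> //; rewrite en en'.
Qed.

Lemma measurable_Tconfig : measurable_fun setT T.
Proof.
apply: (@measurability _ _ config config setT T coord_cylinders) => //.
move=> _ [_ [n _ [B _ <-]] <-]; rewrite !setTI.
have mT : measurable [set e | T e n = true].
  rewrite (_ : [set e | _] = [set e | bounded_past (path e) /\ (e n = false /\
      exists l : int, l <= n - 1 /\ path e (n - 1) < path e l)]).
    apply: measurable_and; first exact: measurable_bounded_past.
    apply: measurable_and; first exact: measurable_coord.
    apply: measurable_ex => l; apply: measurable_and; first exact: measurable_const.
    exact: (measurable_rel2 (fun a b => a < b)) (int_measurable_path _) (int_measurable_path _).
  by apply/seteqP; split=> e /= /TconfigP.
rewrite (_ : _ @^-1` _ = [set e | T e n = true /\ B true \/ (~ T e n = true) /\ B false]).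
  apply: measurable_or; apply: measurable_and; try exact: measurable_const.
    by [].
  exact: measurable_not.
apply/seteqP; split=> e /=; case: (T e n) => //; first by left.
- by right.
- by case=> -[].
- by case=> -[].
Qed.

(** An empty site stays empty exactly when the carrier arrives empty, and the up-step from the
    maximum is then a record. *)
Lemma record_config e n : bounded_past (path e) ->
  (record (path e) n <-> e n = false /\ T e n = false).
Proof.
move=> be; split=> [rn|[en Tn] l ln].
  have en : e n = false.
    by have := rn (n - 1); have := path_config e n; case: (e n) => //; lia.
  split=> //; apply/negP => /TconfigP[_ [_ [l [ln Sl]]]].
  by have := rn l; have := path_config e n; rewrite en; lia.
rewrite (path_config e n) en.
have : ~ path e (n - 1) < path e l.
  move=> Sl; have : T e n = true; last by rewrite Tn.
  by apply/TconfigP; split=> //; split=> //; exists l; split=> //; lia.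
lia.
Qed.

(* [T] turns each end of a run of particles into the beginning of the next run. *)
Lemma Tconfig_descent e n : bounded_past (path e) ->
  (e n = true /\ e (n + 1) = false <-> T e n = false /\ T e (n + 1) = true).
Proof.
move=> be; have n1 : n + 1 - 1 = n by lia.
have Sn := path_config e n.
split=> [[en en1]|[Tn /TconfigP[_ [en1]]]].
  split; first by apply/negP => /TconfigP[_ []]; rewrite en.
  apply/TconfigP; split=> //; split=> //; exists (n - 1); rewrite n1; split; first lia.
  by rewrite Sn en; lia.
rewrite n1 => -[l [ln Sl]]; split=> //.
(* Were [n] empty in both configurations, it would be a record, against the nonempty carrier that
   drops a particle at [n + 1]. *)
case en : (e n) Sn => // Sn.
have rn : record (path e) n by apply/record_config.
by have [lE|lNn] := eqVneq l n; [rewrite lE ltxx in Sl|have := rn l; lia].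
Qed.

End Tconfig.

(** * Measure-preserving maps *)

Section measure_preserving.
Context {d : measure_display} {X : measurableType d} {R : realType}.
Variables (mu : {measure set X -> \bar R}) (T : X -> X).
Hypotheses (mu1 : mu setT = 1%E) (mT : measurable_fun setT T).
Hypothesis muT : forall A, measurable A -> mu (T @^-1` A) = mu A.

Definition prob (A : X -> Prop) : R := fine (mu [set e | A e]).

Lemma measurable_preimage {A : X -> Prop} :
  measurable [set e | A e] -> measurable [set e | A (T e)].
Proof. by move=> mA; rewrite -[X in measurable X]setTI; exact: mT. Qed.

Lemma measure_prob {A : X -> Prop} : measurable [set e | A e] -> mu [set e | A e] = (prob A)%:E.
Proof.
move=> mA; rewrite /prob fineK// ge0_fin_numE; last exact: measure_ge0.
by apply: (@le_lt_trans _ _ 1%E); rewrite ?ltry// -mu1 le_measure// inE.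
Qed.

Lemma prob_ge0 A : 0 <= prob A.
Proof. exact: fine_ge0. Qed.

Lemma prob_split {A B : X -> Prop} : measurable [set e | A e] -> measurable [set e | B e] ->
  prob A = prob (fun e => A e /\ ~ B e) + prob (fun e => A e /\ B e).
Proof.
move=> mA mB; apply: EFin_inj; rewrite EFinD -!measure_prob//; last 2 first.
- exact: (measurable_and mA mB).
- exact: (measurable_and mA (measurable_not mB)).
by rewrite (measureDI mu mA mB).
Qed.

Lemma prob_preimage (A : X -> Prop) : measurable [set e | A e] ->
  prob (fun e => A (T e)) = prob A.
Proof. by move=> mA; rewrite /prob -(muT _ mA). Qed.

Lemma ae_prob0 (A : X -> Prop) : measurable [set e | A e] ->
  ({ae mu, forall e, ~ A e} <-> prob A = 0).
Proof.
move=> mA.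
have -> : {ae mu, forall e, ~ A e} = mu.-negligible [set e | A e].
  rewrite /almost_everywhere /=; congr (mu.-negligible _); apply/seteqP.
  by split=> e /=; [exact: contrapT|by move=> Ae nA; exact: nA].
rewrite negligibleP//; split=> [|p0].
  by rewrite /prob => ->.
by apply: etrans (measure_prob mA) _; rewrite p0.
Qed.

Lemma ae_preimage {A : X -> Prop} : {ae mu, forall e, A e} -> {ae mu, forall e, A (T e)}.
Proof.
move=> [N [mN N0 AN]]; exists (T @^-1` N); split.
- exact: measurable_preimage.
- by rewrite muT.
- by move=> e nA; exact: AN.
Qed.

(** The complement of [A] has the same measure as its preimage, so a property can be pulled back to
    an earlier time. *)
Lemma ae_of_preimage (A : X -> Prop) : measurable [set e | A e] ->
  {ae mu, forall e, A (T e)} -> {ae mu, forall e, A e}.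
Proof.
move=> mA AT; have mnA := measurable_not mA.
suff : {ae mu, forall e, ~ ~ A e} by apply: filterS => e; exact: contrapT.
apply/ae_prob0 => //; rewrite -prob_preimage//; apply/ae_prob0.
  exact: (measurable_preimage mnA).
by apply: filterS AT => e ? ?.
Qed.

Lemma ae_iter (A : X -> Prop) : {ae mu, forall e, A e} ->
  {ae mu, forall e, forall j, A (iter j T e)}.
Proof.
move=> aA; apply: ae_foralln; elim=> [//|j IH].
by have := ae_preimage IH; apply: filterS => e; rewrite -iterSr.
Qed.

Lemma ae_forall_int (A : int -> X -> Prop) :
  (forall n, {ae mu, forall e, A n e}) -> {ae mu, forall e, forall n, A n e}.
Proof.
move=> aA.
have h : {ae mu, forall e, forall k : nat, A k%:Z e /\ A (- k%:Z) e}.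
  by apply: ae_foralln => k; apply: filterS2 (aA k%:Z) (aA (- k%:Z)) => e.
apply: filterS h => e h n; have [n0|n0] := leP 0 n.
  by rewrite (_ : n = `|n|%N%:Z); [exact: (h _).1|lia].
by rewrite (_ : n = - `|n|%N%:Z); [exact: (h _).2|lia].
Qed.

Lemma prob_ae_eq (A B : X -> Prop) : measurable [set e | A e] -> measurable [set e | B e] ->
  {ae mu, forall e, A e <-> B e} -> prob A = prob B.
Proof.
move=> mA mB AB.
have h (C D : X -> Prop) : measurable [set e | C e] -> measurable [set e | D e] ->
    {ae mu, forall e, C e <-> D e} -> prob (fun e => C e /\ ~ D e) = 0.
  move=> mC mD CD; apply/ae_prob0; first exact: (measurable_and mC (measurable_not mD)).
  by apply: filterS CD => e CD [/CD].
rewrite (prob_split mA mB) (prob_split mB mA) h// [in RHS]h//; last first.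
  by apply: filterS AB => e; case; split.
by congr (_ + prob _); apply/funext => e; apply/propext; split=> -[].
Qed.

Lemma prob_le (A B : X -> Prop) : measurable [set e | A e] -> measurable [set e | B e] ->
  (forall e, A e -> B e) -> prob A <= prob B.
Proof.
move=> mA mB AB; rewrite (prob_split mB mA) [in leLHS](_ : A = fun e => B e /\ A e).
  by rewrite lerDr prob_ge0.
by apply/funext => e; apply/propext; split=> [Ae|[]//]; split=> //; exact: AB.
Qed.

Section invariant.
Variable E : X -> Prop.
Hypotheses (mE : measurable [set e | E e]) (ET : {ae mu, forall e, E e -> E (T e)}).

(** [E] is almost surely contained in its preimage, which has the same finite measure; the
    difference is null. *)
Lemma ae_invariant : {ae mu, forall e, E e <-> E (T e)}.
Proof.
have mET := measurable_preimage mE.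
suff : {ae mu, forall e, ~ (E (T e) /\ ~ E e)}.
  move=> sf; apply: filterS2 ET sf => e h1 h2; split=> // ETe.
  by apply: contrapT => nE; exact: (h2 (conj ETe nE)).
apply/ae_prob0; first exact: (measurable_and mET (measurable_not mE)).
have := prob_split mE mET; have := prob_split mET mE.
rewrite prob_preimage//.
have -> : prob (fun e => E e /\ ~ E (T e)) = 0.
  apply/ae_prob0; first exact: (measurable_and mE (measurable_not mET)).
  by apply: filterS ET => e h [/h].
have -> : (fun e => E (T e) /\ E e) = (fun e => E e /\ E (T e)).
  by apply/funext => e; apply/propext; split=> -[].
by move=> h1 h2; move: h1; rewrite h2 add0r -[X in X = _]add0r => /addIr.
Qed.

Lemma prob_invariant (A B : X -> Prop) :
  measurable [set e | A e] -> measurable [set e | B e] ->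
  {ae mu, forall e, A e <-> B (T e)} ->
  prob (fun e => A e /\ E e) = prob (fun e => B e /\ E e).
Proof.
move=> mA mB AB; have mBE := measurable_and mB mE.
rewrite -[RHS]prob_preimage//; apply: prob_ae_eq.
- exact: measurable_and.
- exact: (measurable_preimage mBE).
- by apply: filterS2 AB ae_invariant => e AB EE; split=> -[/AB ? /EE ?].
Qed.

End invariant.

(** The tail unions decrease to the null event that infinitely many [A k] occur, yet each has
    measure at least [p]. *)
Lemma prob_io_const (A : nat -> X -> Prop) (p : R) :
  (forall k, measurable [set e | A k e]) -> (forall k, prob (A k) = p) ->
  {ae mu, forall e, ~ (forall n, exists k, (n <= k)%N /\ A k e)} -> p = 0.
Proof.
move=> mA pA io.
pose F n := [set e | exists k, (n <= k)%N /\ A k e].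
have mF n : measurable (F n).
  by apply: measurable_ex => k; apply: measurable_and; [exact: measurable_const|].
have mF' : measurable (\bigcap_n F n) by apply: bigcapT_measurable.
have F0 : mu (\bigcap_n F n) = 0%E.
  have -> : \bigcap_n F n = [set e | forall n, F n e].
    by apply/seteqP; split=> e /= h n; [exact: h|move=> _; exact: h].
  rewrite measure_prob; last exact: measurable_all.
  by congr (_%:E); apply/ae_prob0; [exact: measurable_all|].
have : mu (F n) @[n --> \oo] --> 0%E.
  rewrite -F0; apply: nonincreasing_cvg_mu => //.
    by rewrite -ge0_fin_numE// (measure_prob (mF 0%N)).
  move=> n m nm; apply/subsetPset => e [k [mk Ak]]; exists k; split=> //.
  exact: leq_trans nm mk.
have pF n : (p%:E <= mu (F n))%E.
  rewrite (measure_prob (mF n)) lee_fin -(pA n); apply: prob_le => // [|e Ae]; first exact: mF.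
  by exists n.
move=> F_0; have : (p%:E <= 0)%E.
  rewrite -(cvg_lim _ F_0)//; apply: lime_ge; last exact: nearW.
  by apply/cvg_ex; exists 0%E.
by rewrite lee_fin => p0; apply/eqP; rewrite eq_le p0 -(pA 0%N) prob_ge0.
Qed.

End measure_preserving.

(** * Stationary configurations *)

Lemma le_sum_ord (f : nat -> int) (J j : nat) :
  (forall i, 0 <= f i) -> (j <= J)%N -> f j <= \sum_(i < J.+1) f i.
Proof.
move=> f0 jJ; have jJ' : (j < J.+1)%N by [].
by rewrite (bigD1 (Ordinal jJ'))//= lerDl; apply: sumr_ge0 => i _.
Qed.

(** This fixes the number of time steps: a load of at least [D / q] meets the hypothesis of the
    traces with [J = 2 * q + 1]. *)
Lemma slope_bound (D w : int) (q : nat) : 0 < D -> 0 <= w -> D <= q%:Z * w ->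
  2 * D < (2 * q + 1)%N%:Z * w.
Proof.
move=> D0 w0 Dw; have w1 : 0 < w by nia.
rewrite PoszD PoszM; nia.
Qed.

Section stationary.
Variables (R : realType) (mu : {measure set config -> \bar R}).
Local Notation T := (Tconfig R).
Local Notation path := path_encoding.
Local Notation prob := (prob mu).
Hypothesis mu1 : mu setT = 1%E.
Hypothesis muT : forall A, measurable A -> mu (T @^-1` A) = mu A.
Hypothesis ae_good : {ae mu, forall e, good (path e)}.

Let mT := measurable_Tconfig R.

Lemma ae_good_iter : {ae mu, forall e, forall j,
  good (iter j pitman (path e)) /\ path (iter j T e) = iter j pitman (path e)}.
Proof.
have := ae_iter _ _ mT muT _ ae_good; apply: filterS => e ge.
suff pe j : path (iter j T e) = iter j pitman (path e) by move=> j; rewrite -pe.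
by elim: j => [//|j IH]; rewrite !iterS path_Tconfig ?IH//; case: (ge j); rewrite IH.
Qed.

Lemma ae_bounded : {ae mu, forall e, bounded_past (path e)}.
Proof. by apply: filterS ae_good => e []. Qed.

Let mocc n : measurable [set e : config | e n = true].
Proof. exact: measurable_coord. Qed.

Section invariant.
Variable E : config -> Prop.
Hypotheses (mE : measurable [set e | E e]) (ET : {ae mu, forall e, E e -> E (T e)}).

Lemma prob_occupied_succ n :
  prob (fun e => e n = true /\ E e) = prob (fun e => e (n + 1) = true /\ E e).
Proof.
have mn k : measurable [set e : config | e k = true /\ E e] := measurable_and (mocc k) mE.
rewrite (prob_split _ mu1 (mn n) (mocc (n + 1))) (prob_split _ mu1 (mn (n + 1)) (mocc n)).
congr (_ + _); last by congr prob; apply/funext => e; apply/propext; tauto.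
(* What remains is that the patterns 10 and 01 at [(n, n + 1)] are equally likely on [E]. *)
have := prob_invariant _ _ mu1 mT muT _ mE ET (fun e => e n = true /\ e (n + 1) = false)
  (fun e => e n = false /\ e (n + 1) = true).
move=> inv; transitivity (prob (fun e => (e n = true /\ e (n + 1) = false) /\ E e)).
  congr prob; apply/funext => e; apply/propext.
  by case: (e (n + 1)); split=> -[[]].
rewrite inv.
- congr prob; apply/funext => e; apply/propext.
  by case: (e n); split=> -[[]].
- exact: (measurable_and (mocc n) (measurable_coord _ _)).
- exact: (measurable_and (measurable_coord _ _) (mocc _)).
- by apply: filterS ae_bounded => e be; exact: Tconfig_descent.
Qed.

Lemma prob_occupied n :
  prob (fun e => e n = true /\ E e) = prob (fun e => e 0 = true /\ E e).
Proof.
have h (k : nat) m : prob (fun e => e (m + k%:Z) = true /\ E e) =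
    prob (fun e => e m = true /\ E e).
  elim: k => [|k IH]; first by rewrite addr0.
  by rewrite -addn1 PoszD addrA -prob_occupied_succ.
have [n0|n0] := leP 0 n; first by rewrite -(h `|n|%N 0) (_ : 0 + _ = n)//; lia.
by rewrite -(h `|n|%N n) (_ : n + _ = 0)//; lia.
Qed.

Lemma prob_record n :
  prob (fun e => record (path e) n /\ E e) =
  prob E - 2 * prob (fun e => e 0 = true /\ E e).
Proof.
have mTn : measurable [set e | T e n = true] := measurable_preimage _ mT (mocc n).
have mEn := measurable_and mE (measurable_not (mocc n)).
rewrite (prob_split _ mu1 mE (mocc n)) (prob_split _ mu1 mEn mTn).
have -> : prob (fun e => E e /\ e n = true) = prob (fun e => e 0 = true /\ E e).
  by rewrite -(prob_occupied n); congr prob; apply/funext => e; apply/propext; tauto.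
have -> : prob (fun e => (E e /\ ~ e n = true) /\ T e n = true) =
    prob (fun e => e 0 = true /\ E e).
  (* A particle of [T e] sits only on an empty site of [e], so the condition on [e n] is automatic,
     and invariance on [E] replaces [T e] by [e]. *)
  rewrite -(prob_occupied n).
  rewrite -(prob_invariant _ _ mu1 mT muT _ mE ET (fun e => T e n = true))//; last exact: aeW.
  congr prob; apply/funext => e; apply/propext; split=> [[[]]//|[Tn Ee]].
  by have /TconfigP[_ [en _]] := Tn; rewrite en.
have -> : prob (fun e => record (path e) n /\ E e) =
    prob (fun e => (E e /\ ~ e n = true) /\ ~ T e n = true).
  apply: prob_ae_eq => //.
  - exact: (measurable_and (measurable_record n) mE).
  - exact: (measurable_and mEn (measurable_not mTn)).
  - apply: filterS ae_bounded => e be; have rE := record_config R e n be.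
    split=> [[/rE[en Tn] Ee]|[[Ee /negP/negbTE en] /negP/negbTE Tn]]; first by rewrite en Tn.
    by split=> //; apply/rE.
lra.
Qed.

(** The probability of a record on [E] is the same at all sites; if records along [x] are almost
    surely finitely many on [E], it is zero. The sequence [x] selects the end. *)
Lemma ae_no_record (x : nat -> int) :
  {ae mu, forall e, E e -> ~ (forall n, exists k, (n <= k)%N /\ record (path e) (x k))} ->
  {ae mu, forall e, E e -> forall n, ~ record (path e) n}.
Proof.
move=> io; pose A k e := record (path e) (x k) /\ E e.
have mA k : measurable [set e | A k e] := measurable_and (measurable_record _) mE.
pose p := prob E - 2 * prob (fun e => e 0 = true /\ E e).
have p0 : p = 0.
  apply: (prob_io_const mu mu1 A) => // [k|]; first exact: prob_record.
  apply: filterS io => e io rec; have [k [_ [_ Ee]]] := rec 0%N.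
  apply: (io Ee) => n; have [j [nj [rj _]]] := rec n; by exists j.
suff : {ae mu, forall e, forall n, ~ (record (path e) n /\ E e)}.
  by apply: filterS => e h Ee n rn; exact: (h n (conj rn Ee)).
apply: ae_forall_int => n; apply/ae_prob0 => //.
  exact: (measurable_and (measurable_record _) mE).
by rewrite prob_record.
Qed.

End invariant.

Lemma ae_no_record_bounded : {ae mu, forall e,
  bounded_right (path e) \/ recurrent_left (path e) -> forall n, ~ record (path e) n}.
Proof.
have h1 : {ae mu, forall e, bounded_right (path e) -> forall n, ~ record (path e) n}.
  apply: (ae_no_record _ measurable_bounded_right _ (fun k => k%:Z)).
    apply: filterS ae_good => e ge be; have [pe bpe _ _] := ge.
    by rewrite path_Tconfig//; exact: bounded_right_pitman.
  apply: aeW => e be rec; apply: (records_unbounded (path e)) be => n.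
  have [k [nk rk]] := rec `|n|%N; exists k%:Z; split=> //; lia.
have h2 : {ae mu, forall e, recurrent_left (path e) -> forall n, ~ record (path e) n}.
  apply: (ae_no_record _ measurable_recurrent_left _ (fun k => - k%:Z)).
    apply: filterS ae_good => e ge be; have [pe bpe _ _] := ge.
    by rewrite path_Tconfig//; exact: recurrent_left_pitman.
  apply: aeW => e be rec; apply: (records_transient_left (path e)) be => n.
  have [k [nk rk]] := rec `|n|%N; exists (- k%:Z); split=> //; lia.
by apply: filterS2 h1 h2 => e h1 h2 [].
Qed.

Lemma ae_critical : {ae mu, forall e,
  bounded_right (path e) \/ recurrent_left (path e) -> S_critical R (path e)}.
Proof.
have h := ae_no_record_bounded; have hT := ae_preimage _ _ mT muT h.
apply: filterS3 ae_good_iter h hT => e ge h1 h2 be.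
have [g0 _] := ge 0%N; have [g1] := ge 1%N; rewrite /= in g0 g1 *.
move=> pT.
have [a [b [ab osc]]] : exists a b : int, a < b /\ oscillates (path e) a b.
  apply: no_record_oscillates => //; first exact: h1.
  rewrite -pT; apply: h2; rewrite pT.
  by case: be => be; [left; exact: bounded_right_pitman|right; exact: recurrent_left_pitman].
by case: g0 => pe _ _ _; exact: (oscillates_critical R _ a b).
Qed.

(** Tracing backwards needs [J] earlier configurations, so the estimate is proved for [iter J T e]
    and pulled back to [e] by invariance. *)
Lemma ae_carrier_sublinear : {ae mu, forall e, forall q, carrier_sublinear (path e) q}.
Proof.
apply: ae_foralln => q; pose J := (2 * q + 1)%N.
suff : {ae mu, forall e, carrier_sublinear (path (iter J T e)) q}.
  elim: J => [//|J IH] h; apply: IH.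
  have mJ : measurable [set e | carrier_sublinear (path (iter J T e)) q].
    elim: J {h} => [|J IH]; first exact: measurable_carrier_sublinear.
    by under eq_set do rewrite iterSr; exact: (measurable_preimage _ mT IH).
  apply: (ae_of_preimage _ _ mu1 mT muT _ mJ).
  by apply: filterS h => e; rewrite iterSr.
apply: filterS ae_good_iter => e ge; rewrite (ge J).2.
(* A load [w] with [D <= q * w] and [w] at most four times the carrier at the origin at time [j]
   gives [D <= f j]; the sum exceeds all these bounds. *)
pose f (j : nat) : int := 4 * q%:Z * `|carrier (iter j pitman (path e)) 0|.
exists (\sum_(j < J.+1) f j + 1) => n n0 Nn.
rewrite ltNge; apply/negP => qw.
set S := iter J pitman (path e) in qw Nn *.
have [pS bS _ _] := (ge J).1.
have w0 := carrier_ge0 _ pS bS n.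
have f0 i : 0 <= f i by rewrite mulr_ge0.
have D0 : 0 < past_max S n - past_max S 0 by have := le_sum_ord f J 0 f0 isT; have := f0 0%N; lia.
have [j [jJ wj]] := backward_trace J (path e) n (carrier S n) (fun j _ => (ge j).1) n0
  (lexx _) (slope_bound _ _ _ D0 w0 qw).
have := le_sum_ord f J j f0 jJ; rewrite {1}/f.
have := ler_norm (carrier (iter j pitman (path e)) 0); nia.
Qed.

(** At the left end the loads are traced forwards from the path itself, so the estimate needs no
    pulling back. *)
Lemma ae_subcritical : {ae mu, forall e,
  ~ (bounded_right (path e) \/ recurrent_left (path e)) -> S_subcritical R (path e)}.
Proof.
apply: filterS2 ae_carrier_sublinear ae_good_iter => e h ge /not_orP[nb nr].
have [pe be _ _] := (ge 0%N).1; rewrite /= in pe be.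
split; last by apply: subcritical_plus.
apply: subcritical_minus => // q; pose J := (2 * q + 1)%N.
pose f (j : nat) : int := 4 * q%:Z * `|carrier (iter j pitman (path e)) 0|.
exists (\sum_(j < J.+1) f j + 1) => n n0 Nn.
rewrite ltNge; apply/negP => qw.
have w0 := carrier_ge0 _ pe be n.
have f0 i : 0 <= f i by rewrite mulr_ge0.
have D0 : 0 < past_max (path e) 0 - past_max (path e) n.
  by have := le_sum_ord f J 0 f0 isT; have := f0 0%N; lia.
have [j [jJ wj]] := forward_trace J (path e) n (carrier (path e) n) (fun j _ => (ge j).1) n0
  (lexx _) (slope_bound _ _ _ D0 w0 qw).
have := le_sum_ord f J j f0 jJ; rewrite {1}/f.
have := ler_norm (carrier (iter j pitman (path e)) 0); nia.
Qed.

End stationary.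

(** * Transfer from the law of the configuration to the probability space *)

Theorem theorem1p2 (d : measure_display) (Omega : measurableType d)
    (R : realType) (P : probability Omega R)
    (eta : Omega -> config) (eta_meas : measurable_fun [set: Omega] eta)
    (eta_rev : {ae P, forall w, Srev R (path_encoding (eta w))})
    (eta_inv : eq_dist P (fun w => Tconfig R (eta w)) eta) :
  {ae P, forall w,
     (S_subcritical R `|` S_critical R) (path_encoding (eta w))} /\
  exists rho : R,
    [/\ 0 <= rho <= 2^-1,
        forall n : int, P [set w | eta w n = true] = rho%:E
      & rho = 2^-1 <->
        {ae P, forall w, S_critical R (path_encoding (eta w))}].
Proof.
have [mu muP] : exists mu : {measure set config -> \bar R}, forall A, mu A = P (eta @^-1` A).
  by exists (measure_function_pushforward__canonical__measure_function_Measure P eta_meas).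
have meta A : measurable A -> measurable (eta @^-1` A).
  by move=> mA; rewrite -[X in measurable X]setTI; exact: eta_meas.
have mu1 : mu setT = 1%E by rewrite muP preimage_setT probability_setT.
have muT A : measurable A -> mu (Tconfig R @^-1` A) = mu A.
  by move=> mA; rewrite !muP; exact: eta_inv.
have ae_law (A : config -> Prop) : {ae mu, forall e, A e} -> {ae P, forall w, A (eta w)}.
  move=> [N [mN N0 AN]]; exists (eta @^-1` N); split; [exact: meta|by rewrite -muP|].
  by move=> w nA; exact: AN.
have ae_of_law (A : config -> Prop) : measurable [set e | A e] ->
    {ae P, forall w, A (eta w)} -> {ae mu, forall e, A e}.
  move=> mA AP; exists (~` [set e | A e]); split=> //; first exact: measurableC.
  rewrite muP; apply/negligibleP; first exact/meta/measurableC.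
  exact: AP.
have gmu : {ae mu, forall e, good (path_encoding e)}.
  by apply: ae_of_law; [exact: measurable_good|apply: filterS eta_rev => w /Srev_good].
have crit := ae_critical R mu mu1 muT gmu.
split.
  apply: (ae_law (fun e => (S_subcritical R `|` S_critical R) (path_encoding e))).
  apply: filterS2 crit (ae_subcritical R mu mu1 muT gmu) => e h1 h2.
  have [b|nb] := pselect (bounded_right (path_encoding e) \/ recurrent_left (path_encoding e)).
    by right; exact: h1.
  by left; exact: h2.
(* The trivial invariant event, on which the density identities hold unconditionally. *)
pose full (e : config) := True.
have mfull : measurable [set e | full e] := measurable_const True.
have fullT : {ae mu, forall e, full e -> full (Tconfig R e)} by exact: aeW.
have prob_full : prob mu full = 1.
  have -> : prob mu full = fine (mu setT) by congr (fine (mu _)); apply/seteqP; split.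
  by rewrite mu1.
pose rho := prob mu (fun e => e 0 = true /\ full e).
have rec n : prob mu (fun e => record (path_encoding e) n /\ full e) = 1 - 2 * rho.
  by rewrite (prob_record R mu mu1 muT gmu full mfull fullT) prob_full.
have mrec n : measurable [set e : config | record (path_encoding e) n /\ full e].
  exact: (measurable_and (measurable_record n) mfull).
exists rho; split.
- apply/andP; split; first exact: prob_ge0.
  have := prob_ge0 mu (fun e => record (path_encoding e) 0 /\ full e).
  by rewrite rec; lra.
- move=> n; rewrite -[LHS](muP [set e | e n = true]) (measure_prob _ mu1);
    last exact: measurable_coord.
  rewrite /rho -(prob_occupied R mu mu1 muT gmu full mfull fullT n).
  by congr (_%:E); congr (prob mu _); apply/funext => e; apply/propext; split=> [|[]].
- split=> [rho2|critP].
    (* Without records the past maximum is constant and bounds the path on the right. *)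
    have norec : {ae mu, forall e, forall n, ~ (record (path_encoding e) n /\ full e)}.
      by apply: ae_forall_int => n; apply/ae_prob0 => //; rewrite rec rho2; lra.
    apply: (ae_law (fun e => S_critical R (path_encoding e))).
    apply: filterS3 crit gmu norec => e h [pe be _ _] nr; apply: h; left.
    exists (past_max (path_encoding e) 0) => m m0.
    rewrite -(no_record_past_max _ pe be _ m); first exact: past_max_ub.
    by move=> n r; exact: (nr n (conj r I)).
  have : 1 - 2 * rho = 0; last lra.
  rewrite -(rec 0); apply/ae_prob0 => //.
  (* [ae_of_law] asks for a measurable event, so criticality is passed on through its consequence
     [bounded_right]. *)
  have br : {ae mu, forall e, bounded_right (path_encoding e)}.
    apply: ae_of_law; first exact: measurable_bounded_right.
    by apply: filterS critP => w; exact: critical_bounded_right.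
  apply: filterS2 br (ae_no_record_bounded R mu mu1 muT gmu) => e be h [re _].
  by apply: (h _ _ re); left.
Qed.
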